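(* Let $\Phi:\mathbb{X}\to\overline{\mathbb{R}}$ be proper, lower semicontinuous and bounded from below, let $m\in\mathbb{N}$, let $\{x^k\}_{k\in\mathbb{N}}\subset\mathbb{X}$ with $\Phi(x^0)<\infty$, and let $\{z^k\}_{k\in\mathbb{N}}\subset\mathbb{Z}=\mathbb{X}\times\mathbb{Y}$ satisfy $\mathcal{P}_{\mathbb{X}}(z^k)=x^k$ for all $k$. Suppose the following four conditions hold. (a) There is $a>0$ such that $\Phi(x^{k+1})+a\|x^{k+1}-x^k\|^2\le\Phi(x^{\ell(k)})$ for all $k\in\mathbb{N}$. (b) For every convergent subsequence $\{x^{\ell(k_j)}\}_{j\in\mathbb{N}}$, $\limsup_{j\to\infty}\Phi(x^{\ell(k_j)})\le\Phi(\lim_{j\to\infty}x^{\ell(k_j)})$. (c) There exist a proper lower semicontinuous KL function $\Theta:\mathbb{Z}\to\overline{\mathbb{R}}$, a sequence $\varsigma_k\ge 0$ with $\lim_{k\to\infty}\varsigma_k=0$, and $b>0$ such that $\Theta(z)\ge\Phi(\mathcal{P}_{\mathbb{X}}(z))$ for every $z\in Z^*$ (the set of cluster points of $\{z^k\}$), $\Phi(x^{k+1})\le\Theta(z^{k+1})\le\Phi(x^{\ell(k)})+\varsigma_k$ for all $k\in\mathbb{N}$, and ${\rm dist}(0,\partial\Theta(z^k))\le b\|x^k-x^{k-1}\|$ for all $k\ge 1$. (d) There exist $\tau\in(0,1)$, $\mu>0$ and an integer $\overline{k}>m$ such that for each $k\ge\overline{k}$ and every integer $i$ with $\ell(k-1)+1\le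 i\le\ell(k)-1$, $$\sqrt{\Phi(x^{\ell(k)})-\Phi(x^i)}\le\tau\sqrt{a}\,\|x^i-x^{i-1}\|+\mu\sum_{j=i+1}^{\ell(k)}\|x^j-x^{j-1}\|.$$ If the sequence $\{z^k\}_{k\in\mathbb{N}}$ is bounded, then $\sum_{k=1}^\infty\|x^{k+1}-x^k\|<\infty$, and hence $\{x^k\}_{k\in\mathbb{N}}$ is convergent.
   Context: $\mathbb{X}$ and $\mathbb{Y}$ are finite-dimensional real inner product spaces ($\mathbb{Y}=\{0\}$ is allowed, in which case $\mathbb{Z}$ is identified with $\mathbb{X}$), $\|\cdot\|$ is the induced norm, $\mathcal{P}_{\mathbb{X}}(x,y)=x$ for $(x,y)\in\mathbb{Z}=\mathbb{X}\times\mathbb{Y}$, $\overline{\mathbb{R}}=(-\infty,\infty]$, $\mathbb{N}=\{0,1,2,\dots\}$. For $k\in\mathbb{N}$, $\ell(k)$ is the largest index in $\arg\max\{\Phi(x^j): j=\max\{0,k-m\},\dots,k\}$. $\partial$ denotes the limiting (Mordukhovich) subdifferential, and ${\rm dist}(0,\emptyset)=\infty$. KL property: for $\eta\in(0,\infty]$ let $\Upsilon_\eta$ be the family of continuous concave $\varphi:[0,\eta)\to\mathbb{R}_+$ that are continuously differentiable on $(0,\eta)$ with $\varphi'>0$ on $(0,\eta)$ and $\varphi(0)=0$. A proper function $h$ has the KL property at $\overline{x}\in{\rm dom}\,\partial h$ if there exist $\eta\in(0,\infty]$, a neighborhood $\mathcal{U}$ of $\overline{x}$ and $\varphi\in\Upsilon_\eta$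 such that $\varphi'(h(x)-h(\overline{x}))\,{\rm dist}(0,\partial h(x))\ge1$ for all $x\in\mathcal{U}$ with $h(\overline{x})<h(x)<h(\overline{x})+\eta$. $h$ is a KL function if it has the KL property at every point of ${\rm dom}\,\partial h$. *)

(* Defs.v *)
From HB Require Import structures.
From mathcomp Require Export all_boot all_order all_algebra.
From mathcomp Require Export all_classical all_reals all_analysis.

Set Implicit Arguments.
Unset Strict Implicit.
Unset Printing Implicit Defensive.

Export Order.TTheory GRing.Theory Num.Theory.
Export numFieldNormedType.Exports.

Local Open Scope classical_set_scope.
Local Open Scope ring_scope.

Definition finite_dimensional (R : realType) (V : lmodType R) : Prop :=
  exists (n : nat) (e : 'I_n -> V),
    forall v, exists c : 'I_n -> R, v = \sum_(i < n) c i *: e i.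

Definition ip_norm (R : realType) (V : lmodType R) (ip : V -> V -> R) (v : V) : R :=
  Num.sqrt (ip v v).

(* The norm, hence the topology, of V is the one induced by ip.  When V = {0}
   both conditions hold trivially. *)
Definition euclidean (R : realType) (V : normedModType R)
    (ip : {dot V for idfun}) : Prop :=
  finite_dimensional V /\ forall v : V, `|v| = ip_norm ip v.

(* The library puts the max norm on X * Y, so every metric quantity on X * Y is
   expressed with ip_norm (prod_ip ipX ipY).  The topology is the same. *)
Definition prod_ip (R : realType) (X Y : lmodType R)
    (ipX : X -> X -> R) (ipY : Y -> Y -> R) (u v : X * Y) : R :=
  ipX u.1 v.1 + ipY u.2 v.2.

Definition proper_fun (R : realType) (V : Type) (f : V -> \bar R) : Prop :=
  (forall x, f x != -oo%E) /\ (exists x, (f x < +oo)%E).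

Definition regular_subdiff (R : realType) (V : normedModType R)
    (ip : V -> V -> R) (f : V -> \bar R) (x : V) : set V :=
  [set v | f x \is a fin_num /\
    (0 <= limf_einf (fun y => (f y - f x - (ip v (y - x))%:E) *
                              ((ip_norm ip (y - x))^-1)%:E) (x^'))%E].

Definition limiting_subdiff (R : realType) (V : normedModType R)
    (ip : V -> V -> R) (f : V -> \bar R) (x : V) : set V :=
  [set v | f x \is a fin_num /\
    exists (xs vs : nat -> V),
      [/\ xs @ \oo --> x,
          f (xs j) @[j --> \oo] --> f x,
          forall j, regular_subdiff ip f (xs j) (vs j)
        & vs @ \oo --> v]].

(* dist(0, A), equal to +oo when A is empty. *)
Definition dist0 (R : realType) (V : lmodType R) (ip : V -> V -> R)
    (A : set V) : \bar R :=
  ereal_inf [set (ip_norm ip v)%:E | v in A].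

(* Only the values of phi on [0, eta[ matter. *)
Definition desingularizing (R : realType) (eta : \bar R) (phi : R -> R) : Prop :=
  let D := [set t : R | 0 <= t /\ (t%:E < eta)%E] in
  [/\ forall t, D t -> 0 <= phi t,
      phi 0 = 0,
      {within D, continuous phi},
      convex_function (E := R^o) D (fun t => - phi t)
    & forall t, 0 < t -> (t%:E < eta)%E ->
        [/\ derivable phi t 1, {for t, continuous (derive1 phi)} & 0 < derive1 phi t]].

(* In the last line fine is applied to a finite number: h xbar is finite since
   xbar has a limiting subgradient, and h x < h xbar + eta excludes +oo. *)
Definition KL_at (R : realType) (V : normedModType R) (ip : V -> V -> R)
    (h : V -> \bar R) (xbar : V) : Prop :=
  exists (eta : \bar R) (U : set V) (phi : R -> R),
    [/\ (0 < eta)%E, nbhs xbar U, desingularizing eta phi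
      & forall x, U x -> (h xbar < h x)%E -> (h x < h xbar + eta)%E ->
          (1 <= (derive1 phi (fine (h x - h xbar)))%:E *
                dist0 ip (limiting_subdiff ip h x))%E].

Definition KL_function (R : realType) (V : normedModType R) (ip : V -> V -> R)
    (h : V -> \bar R) : Prop :=
  forall xbar, limiting_subdiff ip h xbar !=set0 -> KL_at ip h xbar.

(* Largest index maximizing u over the window max{0, k - m}, ..., k. *)
Definition last_argmax (R : realType) (m : nat) (u : nat -> \bar R) (k : nat) : nat :=
  (\max_(j < k.+1 | (k - m <= j)%N &&
      [forall i : 'I_k.+1, (k - m <= i)%N ==> (u i <= u j)%E]) j)%N.

(* Main.v *)
Require Import Defs.
From mathcomp Require Import ring lra zify.

(** Write d k for the step |x k - x k.-1| and V k for Phi (x (ell k)). By condA,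
    V is nonincreasing, so it decreases to a limit om, and condA bounds
    a * d k.+1 ^ 2 by V k - Phi (x k.+1). When k.+1 is a value of ell, this is a
    drop of V. At the other indices condD bounds the square root of the discrepancy
    by a fraction of the step itself and the later steps up to the next value of
    ell, at most m of them; absorbing the former and unrolling the latter
    backwards gives
    d i.+1 <= C * sqrt (V i - V (i + m).+1) for every large i (step_le_sqrt_drop).
    In particular the steps vanish.

    Let w be a cluster point of z. As the steps vanish, x (ell k) follows x k, and
    condB gives om <= Phi w.1 <= Theta w, while semicontinuity and the upper bound
    on Theta (z k) give Theta w <= om. As dist (0, subdifferential) tends to 0
    along z, 0 is a limiting subgradient of Theta at w (cluster_critical), so the
    KL property applies near w. The desingularizing functions of finitely many
    such points add up, and compactness of bounded sets in finite dimension yields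
    one function phi for the whole sequence (kl_along_sequence).

    The KL inequality is used only at the indices ell k. There
    V k <= Theta (z (ell k)), and the derivative of phi is nonincreasing, so that
    1 <= phi' (V k - om) * b * d (ell k). Concavity turns this into
    V k - V (k + m).+1 <= b * d (ell k) * (phi_k - phi_(k + m + 1)), where
    phi_k = phi (V k - om). Inserted in the step bound, this gives by AM-GM half
    of an average of the preceding m + 1 steps plus a term that telescopes, and
    the sum of the steps is finite (sums_bounded_of_gauge). *)

Set Implicit Arguments.
Unset Strict Implicit.
Unset Printing Implicit Defensive.

Local Open Scope classical_set_scope.
Local Open Scope ring_scope.

(** * Partial sums of nonnegative sequences *)

Lemma sum_shift (R : realFieldType) (d : nat -> R) (N j : nat) :
  \sum_(0 <= i < N) d (i + j)%N = \sum_(j <= i < N + j) d i.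
Proof. by rewrite -{2}(add0n j) big_addn addnK. Qed.

Lemma sum_shift_le (R : realFieldType) (d : nat -> R) (N M j : nat) :
  (forall i, 0 <= d i) -> (j <= M)%N ->
  \sum_(0 <= i < N) d (i + j)%N <= \sum_(0 <= i < N + M) d i.
Proof.
move=> d0 jM; rewrite sum_shift [leRHS](@big_cat_nat _ _ _ j) //=; last by lia.
rewrite [X in _ <= _ + X](@big_cat_nat _ _ _ (N + j)) //=; [|lia|lia].
by rewrite addrCA lerDl addr_ge0 // sumr_ge0.
Qed.

Lemma sum_drop_le (R : realFieldType) (g : nat -> R) (N M : nat) :
  (forall i, 0 <= g i) ->
  \sum_(0 <= i < N) (g i - g (i + M)%N) <= \sum_(0 <= i < M) g i.
Proof.
move=> g0.
rewrite sumrB lerBlDr sum_shift -big_cat_nat ?leq_addl //=.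
by rewrite [leRHS](@big_cat_nat _ _ _ N) //= ?lerDl ?sumr_ge0 //; lia.
Qed.

(** Each d j enters at most M of the averages, so summing the recursion bounds
    a partial sum by half of itself plus a bounded remainder: the first M terms
    and the telescoping differences of g. *)
Lemma sums_bounded_of_averaging (R : realFieldType) (M : nat) (d g : nat -> R) :
  (0 < M)%N -> (forall i, 0 <= d i) -> (forall i, 0 <= g i) ->
  (forall i, d (i + M)%N <=
     (2 * M%:R)^-1 * \sum_(0 <= j < M) d (i + j)%N + (g i - g (i + M)%N)) ->
  exists B, forall N, \sum_(0 <= i < N) d i <= B.
Proof.
move=> M0 d0 g0 rec.
exists (2 * \sum_(0 <= i < M) d i + 2 * \sum_(0 <= i < M) g i) => N.
have MR : (0 : R) < M%:R by rewrite ltr0n.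
apply: (@le_trans _ _ (\sum_(0 <= i < N + M) d i)).
  by rewrite [leRHS](@big_cat_nat _ _ _ N) //= ?lerDl ?sumr_ge0 // leq_addr.
have split_sum : \sum_(0 <= i < N + M) d i =
    \sum_(0 <= i < M) d i + \sum_(0 <= i < N) d (i + M)%N.
  rewrite (@big_cat_nat _ _ _ M) ?leq_addl //=; congr (_ + _).
  by rewrite sum_shift.
have tail : \sum_(0 <= i < N) d (i + M)%N <=
    2^-1 * \sum_(0 <= i < N + M) d i + \sum_(0 <= i < M) g i.
  apply: le_trans (ler_sum_nat (fun i _ => rec i)) _.
  rewrite big_split /= lerD ?sum_drop_le // -mulr_sumr exchange_big_nat /=.
  apply: (@le_trans _ _ ((2 * M%:R)^-1 *
      \sum_(0 <= j < M) \sum_(0 <= i < N + M) d i)).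
    rewrite ler_pM2l ?invr_gt0 ?mulr_gt0 //.
    by apply: ler_sum_nat => j /andP[_ /ltnW jM]; exact: sum_shift_le.
  rewrite sumr_const_nat subn0 -[X in _ * X]mulr_natl mulrA.
  by rewrite invfM divfK // gt_eqF.
move: split_sum tail; lra.
Qed.

Lemma sums_bounded_of_eventually0 (R : realFieldType) (d : nat -> R) (N : nat) :
  (forall i, 0 <= d i) -> (forall i, (N <= i)%N -> d i = 0) ->
  exists B, forall n, \sum_(0 <= i < n) d i <= B.
Proof.
move=> d0 dN; exists (\sum_(0 <= i < N) d i) => n.
have tail p q : (N <= p)%N -> \sum_(p <= i < q) d i = 0.
  move=> Np; rewrite big_nat_cond big1 // => i /andP[/andP[pi _] _].
  by rewrite dN // (leq_trans Np).
have [nN|/ltnW Nn] := leqP n N.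
  by rewrite [leRHS](@big_cat_nat _ _ _ n) //= lerDl sumr_ge0.
by rewrite (@big_cat_nat _ _ _ N) //= (tail N n) ?addr0.
Qed.

(** * Descent with respect to a window maximum *)

Lemma last_argmax_spec (R : realType) (m : nat) (u : nat -> \bar R) (k : nat) :
  let l := last_argmax m u k in
  (k - m <= l <= k)%N /\
  forall i, (k - m <= i <= k)%N -> (u i <= u l)%E.
Proof.
pose Q := fun j : 'I_k.+1 => (k - m <= j)%N &&
      [forall i : 'I_k.+1, (k - m <= i)%N ==> (u i <= u j)%E].
have Q0 : (k - m <= (@ord_max k))%N by rewrite /= leq_subr.
have [j0 Qj0] : exists j0, Q j0.
  case: (@arg_maxP _ _ _ (@ord_max k)
    (fun j : 'I_k.+1 => (k - m <= j)%N) (fun j => u j) Q0) => j mj jmax.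
  by exists j; rewrite /Q mj; apply/forallP => i; apply/implyP/jmax.
have Qgt0 : (0 < #|Q|)%N by apply/card_gt0P; exists j0.
have [j Qj lj] := eq_bigmax_cond (fun j : 'I_k.+1 => nat_of_ord j) Qgt0.
move=> l; have -> : l = j by rewrite -lj.
move: Qj => /andP[mj /forallP jmax]; split.
  by rewrite mj -ltnS ltn_ord.
move=> i /andP[mi ik].
by have := jmax (Ordinal (ik : (i < k.+1)%N)); rewrite /= mi.
Qed.

(** Descent gives a * d i ^ 2 <= u (ell i.-1) - u i, which is a drop of the
    monotone sequence u o ell only when i is itself a value of ell. Between two
    values of ell, u i may lie far below u (ell k), and the last hypothesis says
    that the square root of this gap costs at most the fraction tau < 1 of the
    step plus a multiple of the later steps up to ell k. Absorbing the fraction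
    leaves (1 - tau) * sqrt a * d i <= S + mu * (later steps), with S the square
    root of a drop of u o ell, and the window length m bounds the number of
    later steps. *)
Lemma step_le_sqrt_drop (R : realType) (m K : nat) (a tau mu : R)
    (u d : nat -> R) (ell : nat -> nat) :
  0 < a -> 0 < tau < 1 -> 0 < mu -> (forall i, 0 <= d i) ->
  (forall k, (k - m <= ell k <= k)%N) ->
  {homo (fun k => u (ell k)) : i j / (i <= j)%N >-> j <= i} ->
  (forall k, u k.+1 + a * d k.+1 ^+ 2 <= u (ell k)) ->
  (forall k i, (K <= k)%N -> (ell k.-1 < i < ell k)%N ->
     Num.sqrt (u (ell k) - u i) <=
     tau * Num.sqrt a * d i + mu * \sum_(i.+1 <= j < (ell k).+1) d j) ->
  exists C, forall i, (K <= i)%N ->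
    d i.+1 <= C * Num.sqrt (u (ell i) - u (ell (i + m).+1)).
Proof.
move=> a0 /andP[tau0 tau1] mu0 d0 win mono desc gap.
have sa0 : 0 < Num.sqrt a by rewrite sqrtr_gt0.
set A : R := (1 - tau) * Num.sqrt a.
have A0 : 0 < A by rewrite mulr_gt0 // subr_gt0.
set q : R := 1 + mu / A.
have q1 : 1 <= q by rewrite lerDl divr_ge0 // ltW.
exists (A^-1 * q ^+ m) => i Ki.
(* the indices in (ell k.-1, ell k] form the block between two consecutive
   values of ell that contains i.+1; it has at most m indices after i.+1 *)
have [k ik kmin] : exists2 k, (i < ell k)%N & forall k', (i < ell k')%N -> (k <= k')%N.
  have ex : exists k, (i < ell k)%N.
    by exists (i + m).+1; have := win (i + m).+1; lia.
  by exists (ex_minn ex); case: ex_minnP.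
have ki : (k <= (i + m).+1)%N by apply: kmin; have := win (i + m).+1; lia.
have ik' : (i < k)%N by have := win k; lia.
have prev : (ell k.-1 <= i)%N.
  by rewrite leqNgt; apply/negP => /kmin; lia.
set S : R := Num.sqrt (u (ell i) - u (ell k)).
have S_le : S <= Num.sqrt (u (ell i) - u (ell (i + m).+1)).
  by rewrite ler_wsqrtr // lerD2l lerN2; exact: mono.
have S0 : 0 <= S by exact: sqrtr_ge0.
have SS : S ^+ 2 = u (ell i) - u (ell k).
  by rewrite sqr_sqrtr // subr_ge0; apply: mono; lia.
pose T j := \sum_(j <= l < (ell k).+1) d l.
have T0 j : 0 <= T j by exact: sumr_ge0.
(* at the end of the block this is descent alone; before it, the square root
   of the gap contributes a tau-fraction of the step itself, absorbed in A *)
have step j : (i < j <= ell k)%N -> A * d j <= S + mu * T j.+1.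
  case: j => // j /andP[ij jk].
  have uj := desc j.
  have Vj : u (ell j) <= u (ell i) by apply: mono.
  have sa2 : Num.sqrt a ^+ 2 = a by rewrite sqr_sqrtr // ltW.
  have dj := d0 j.+1.
  have [jlt|jge] := ltnP j.+1 (ell k); last first.
    have jE : j.+1 = ell k by apply/eqP; rewrite eqn_leq jk jge.
    have sd : Num.sqrt a * d j.+1 <= S.
      rewrite -(@ler_pXn2r _ 2) ?nnegrE ?mulr_ge0 ?(ltW sa0) // exprMn sa2 SS.
      by move: uj; rewrite jE; lra.
    apply: (@le_trans _ _ (Num.sqrt a * d j.+1)).
      rewrite /A -mulrA ler_piMl ?mulr_ge0 ?(ltW sa0) //; lra.
    by rewrite (le_trans sd) // lerDl mulr_ge0 // ltW.
  have gapj := gap k j.+1 ltac:(lia) ltac:(lia).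
  rewrite -/(T j.+2) in gapj.
  set W := tau * Num.sqrt a * d j.+1 + mu * T j.+2 in gapj.
  have W0 : 0 <= W.
    by rewrite addr_ge0 // !mulr_ge0 // ltW.
  have drop : u (ell k) - u j.+1 <= W ^+ 2.
    have [le0|ge0] := lerP (u (ell k) - u j.+1) 0.
      by rewrite (le_trans le0) // sqr_ge0.
    by rewrite -[leLHS](sqr_sqrtr (ltW ge0)) ler_pXn2r ?nnegrE ?sqrtr_ge0.
  have : Num.sqrt a * d j.+1 <= S + W.
    rewrite -(@ler_pXn2r _ 2) ?nnegrE ?(addr_ge0 S0 W0) ?mulr_ge0 ?(ltW sa0) //.
    rewrite exprMn sa2 sqrrD SS.
    have : 0 <= S * W by rewrite mulr_ge0.
    by lra.
  have -> : A * d j.+1 = Num.sqrt a * d j.+1 - tau * Num.sqrt a * d j.+1.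
    by rewrite /A; ring.
  by rewrite lerBlDr -addrA [mu * _ + _]addrC.
(* backward induction from the end of the block *)
have grow n : (n <= ell k - i)%N -> S + mu * T ((ell k).+1 - n)%N <= q ^+ n * S.
  elim: n => [_|n IH nk].
    by rewrite subn0 /T big_geq // mulr0 addr0 expr0 mul1r.
  have jE : ((ell k).+1 - n = ((ell k).+1 - n.+1).+1)%N by lia.
  have st := step ((ell k).+1 - n.+1)%N ltac:(lia).
  have IHn := IH ltac:(lia); rewrite jE in IHn.
  set j := ((ell k).+1 - n.+1)%N in jE st IHn *.
  have TE : T j = d j + T j.+1 by rewrite /T big_ltn //; lia.
  have dle : d j <= A^-1 * (S + mu * T j.+1).
    by rewrite ler_pdivlMl.
  apply: (@le_trans _ _ (q * (S + mu * T j.+1))).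
    rewrite TE /q mulrDl mul1r mulrDr addrCA [leRHS]addrC lerD2r.
    by rewrite -mulrA ler_pM2l.
  by rewrite exprS -mulrA ler_pM2l //; lra.
have main : A * d i.+1 <= q ^+ m * S.
  apply: (le_trans (step i.+1 _)); first by lia.
  have := grow (ell k - i.+1)%N ltac:(lia).
  have -> : ((ell k).+1 - (ell k - i.+1) = i.+2)%N by lia.
  move=> /le_trans; apply; apply: ler_wpM2r => //.
  by apply: ler_weXn2l => //; have := win k; lia.
rewrite -mulrA ler_pdivlMl //; apply: (le_trans main).
by apply: ler_wpM2l => //; rewrite exprn_ge0 //; lra.
Qed.

(** At most m vanishing steps separate l k from k. *)
Lemma cvg_window_diff (R : realType) (V : normedModType R) (x : nat -> V)
    (m : nat) (l : nat -> nat) :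
  (fun k => `|x k.+1 - x k|) @ \oo --> (0 : R) ->
  (forall k, (k - m <= l k <= k)%N) ->
  (fun k => `|x (l k) - x k|) @ \oo --> (0 : R).
Proof.
move=> step0 win; apply/cvgrPdistC_le => e e0.
have e'0 : 0 < e / m.+1%:R by rewrite divr_gt0.
move/cvgrPdistC_le: step0 => /(_ _ e'0)[N _ HN].
exists (N + m)%N => // k /= Nk; rewrite subr0 normr_id.
have back p : (p <= m)%N -> `|x (k - p)%N - x k| <= p%:R * (e / m.+1%:R).
  elim: p => [|p IH] pm; first by rewrite subn0 subrr normr0 mul0r.
  have kE : (k - p = (k - p.+1).+1)%N by lia.
  rewrite -(subrK (x (k - p)%N) (x (k - p.+1)%N)) -addrA.
  rewrite (le_trans (ler_normD _ _)) // -natr1 mulrDl mul1r [leRHS]addrC.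
  apply: lerD; last by apply: IH; lia.
  have := HN (k - p.+1)%N; rewrite /= subr0 normr_id kE distrC; apply; lia.
have -> : l k = (k - (k - l k))%N by have := win k; lia.
apply: le_trans (back _ _) _; first by have := win k; lia.
rewrite mulrA mulrAC ler_piMl ?(ltW e0) // ler_pdivrMr ?ltr0n // mul1r ler_nat.
by have := win k; lia.
Qed.

(** * Concave gauges *)

(** What the argument keeps of a desingularizing function phi with derivative
    psi: the tangent inequality replaces concavity and differentiability, so
    that the sum of two gauges is again one, with slope the sum of the slopes. *)
Definition concave_gauge (R : realType) (eta : R) (phi psi : R -> R) : Prop :=
  [/\ 0 < eta,
      forall t, 0 < t < eta -> 0 <= phi t,
      forall t, 0 < t < eta -> 0 <= psi t
    & forall s t, 0 < s < eta -> 0 < t < eta -> phi t <= phi s + psi s * (t - s)].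

Lemma concave_gaugeD (R : realType) (eta1 eta2 : R) (phi1 phi2 psi1 psi2 : R -> R) :
  concave_gauge eta1 phi1 psi1 -> concave_gauge eta2 phi2 psi2 ->
  concave_gauge (Num.min eta1 eta2) (phi1 \+ phi2) (psi1 \+ psi2).
Proof.
move=> [e1 p1 q1 t1] [e2 p2 q2 t2].
have split12 t : 0 < t < Num.min eta1 eta2 -> (0 < t < eta1) /\ (0 < t < eta2).
  by rewrite lt_min => /andP[-> /andP[-> ->]].
split; first by rewrite lt_min e1 e2.
- by move=> t /split12[/p1 ? /p2 ?]; exact: addr_ge0.
- by move=> t /split12[/q1 ? /q2 ?]; exact: addr_ge0.
move=> s t /split12[s1 s2] /split12[u1 u2] /=.
have := t1 _ _ s1 u1; have := t2 _ _ s2 u2; lra.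
Qed.

(** Add the tangent inequality at s, evaluated at t, to the one at t, evaluated
    at s. *)
Lemma concave_gauge_slope_anti (R : realType) (eta : R) (phi psi : R -> R) :
  concave_gauge eta phi psi ->
  forall s t, 0 < s -> s <= t -> t < eta -> psi t <= psi s.
Proof.
move=> [_ _ _ tan] s t s0 st te.
have sI : 0 < s < eta by rewrite s0 (le_lt_trans st).
have tI : 0 < t < eta by rewrite te (lt_le_trans s0).
move: st; rewrite le_eqVlt => /predU1P[->//|st].
have := tan _ _ sI tI; have := tan _ _ tI sI => h1 h2.
by rewrite -(@ler_pM2r _ (t - s)) ?subr_gt0 //; lra.
Qed.

(** Chords of a concave function from s lie below the graph, and their slopes
    near s tend to the derivative. *)
Lemma concave_tangent (R : realType) (D : set R) (phi : R -> R) (s t : R) :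
  convex_function (E := R^o) D (fun r => - phi r) -> D s -> D t ->
  derivable phi s 1 -> phi t <= phi s + derive1 phi s * (t - s).
Proof.
move=> cvx Ds Dt der.
have chord (l : R) : 0 <= l <= 1 -> l * (phi t - phi s) <= phi (s + l * (t - s)) - phi s.
  move=> /andP[l0 l1].
  have := cvx (Itv01 l0 l1) t s (mem_set Dt) (mem_set Ds).
  rewrite [X in _ <= X -> _]convRE /=.
  rewrite [conv _ _ _](_ : _ = s + l * (t - s)); last first.
    by apply: etrans (convRE _ _ _) _; rewrite /= /unstable.onem; ring.
  rewrite /unstable.onem; lra.
have [->|st] := eqVneq t s; first by rewrite subrr mulr0 addr0.
rewrite leNgt; apply/negP => bad.
pose e := phi t - phi s - derive1 phi s * (t - s).
have e0 : 0 < e by rewrite /e; lra.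
have ts0 : 0 < `|t - s| by rewrite normr_gt0 subr_eq0.
move/cvgrPdist_lt: der => /(_ (e / `|t - s|)); rewrite divr_gt0 // => /(_ isT).
rewrite -[lim _]/('D_1 phi s) -derive1E => /nbhs_ballP[del /= del0 H].
pose l := Num.min 1 (del / (2 * `|t - s|)).
have l0 : 0 < l by rewrite lt_min ltr01 divr_gt0 // mulr_gt0.
have l1 : l <= 1 by rewrite ge_min lexx.
set h : R := l * (t - s).
have h0 : h != 0 by rewrite mulf_neq0 ?subr_eq0 // gt_eqF.
have hn : `|h| = l * `|t - s| by rewrite normrM gtr0_norm.
have hdel : `|h| < del.
  apply: (@le_lt_trans _ _ (del / 2)); last by lra.
  rewrite hn -ler_pdivlMr // -mulrA -invfM.
  by rewrite ge_min lexx orbT.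
have hball : ball (0 : R) del h by rewrite -ball_normE /ball_ /= sub0r normrN.
have := H h hball h0 => /=; rewrite [h *: _]mulr1 -[_ *: _]/(h^-1 * _).
rewrite ltr_pdivlMr // -(@ltr_pM2l _ l) // mulrCA -hn -normrM mulrBl.
rewrite mulrAC mulVf // mul1r ltr_norml => /andP[+ _].
have := chord l; rewrite (ltW l0) l1 => /(_ isT); rewrite -/h [s + h]addrC /e.
rewrite /h; lra.
Qed.

Lemma desingularizing_gauge (R : realType) (eta : \bar R) (phi : R -> R) :
  (0 < eta)%E -> desingularizing eta phi ->
  exists2 e : R, (e%:E <= eta)%E & concave_gauge e phi (derive1 phi).
Proof.
move=> eta0 [phi0 _ _ cvx der].
have [e e0 ee] : exists2 e : R, 0 < e & (e%:E <= eta)%E.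
  case: eta eta0 {phi0 cvx der} => [r r0| _|//]; first by exists r.
  by exists 1; rewrite ?leey.
exists e => //.
have D t : 0 < t < e -> 0 < t /\ (t%:E < eta)%E.
  by move=> /andP[t0 te]; split => //; apply: lt_le_trans ee; rewrite lte_fin.
split => //.
- by move=> t /D[t0 te]; apply: phi0; split => //; exact: ltW.
- by move=> t /D[t0 te]; have [_ _ /ltW] := der t t0 te.
move=> s t /D[s0 se] /D[t0 te].
have [ds _ _] := der s s0 se.
by apply: (concave_tangent cvx) => //; split => //; exact: ltW.
Qed.

(** The tangent inequality at V k - om, multiplied by b * d (ell k), turns the
    last hypothesis into
    V k - V (k + m).+1 <= b * d (ell k) * (phi_k - phi_(k + m + 1)), where phi_k
    is phi (V k - om). Under the square root of the step bound, AM-GM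
    then gives d k.+1 <= d (ell k) / (2 (m + 1)) + c * (phi_k - phi_(k + m + 1)).
    As ell k is one of the m + 1 indices up to k, this is the recursion of
    sums_bounded_of_averaging; nonnegativity of phi keeps the telescoping sum
    bounded. *)
Lemma sums_bounded_of_gauge (R : realType) (m K : nat) (om b C eta : R)
    (phi psi : R -> R) (V d : nat -> R) (ell : nat -> nat) :
  concave_gauge eta phi psi -> 0 <= b -> (forall i, 0 <= d i) ->
  (forall k, (k - m <= ell k <= k)%N) ->
  {homo V : i j / (i <= j)%N >-> j <= i} ->
  (forall k, (K <= k)%N -> 0 < V k - om < eta) ->
  (forall k, (K <= k)%N -> d k.+1 <= C * Num.sqrt (V k - V (k + m).+1)) ->
  (forall k, (K <= k)%N -> 1 <= psi (V k - om) * (b * d (ell k))) ->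
  exists B, forall N, \sum_(0 <= i < N) d i <= B.
Proof.
move=> [eta0 phi0 psi0 tan] b0 d0 win mono VI step kl.
set M := m.+1.
have MR : (0 : R) < M%:R by rewrite ltr0n.
pose c : R := C ^+ 2 * b * M%:R / 2.
have c0 : 0 <= c.
  by rewrite /c mulr_ge0 // mulr_ge0 // mulr_ge0 // sqr_ge0.
pose g i := c * phi (V (K + i + m)%N - om).
have g0 i : 0 <= g i by rewrite /g mulr_ge0 // phi0 // VI // -addnA leq_addr.
have [B HB] : exists B, forall N, \sum_(0 <= i < N) d (K + i)%N <= B.
  apply: (@sums_bounded_of_averaging _ M (fun i => d (K + i)%N) g) => // i.
  set k := (K + i + m)%N.
  have Kk : (K <= k)%N by rewrite /k; lia.
  have -> : (K + (i + M) = k.+1)%N by rewrite /k /M; lia.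
  have -> : g i - g (i + M)%N = c * (phi (V k - om) - phi (V (k + m).+1 - om)).
    by rewrite /g -/k mulrBr (_ : (K + (i + M) + m = (k + m).+1)%N) // /k /M; lia.
  set D := phi _ - phi _.
  have := tan _ _ (VI k Kk) (VI (k + m).+1 ltac:(lia)).
  rewrite (_ : V (k + m).+1 - om - (V k - om) = - (V k - V (k + m).+1)); last by ring.
  set v := V k - V _; rewrite mulrN => tan'.
  have v0 : 0 <= v by rewrite subr_ge0; apply: mono; lia.
  set l := d (ell k).
  have l0 : 0 <= l by exact: d0.
  have psiv : psi (V k - om) * v <= D by rewrite /D; lra.
  have vle : v <= b * l * D.
    apply: (@le_trans _ _ (psi (V k - om) * (b * l) * v)).
      by rewrite ler_peMl //; exact: kl.
    rewrite mulrAC [leRHS]mulrC ler_wpM2r ?mulr_ge0 //.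
  have D0 : 0 <= D by apply: le_trans psiv; rewrite mulr_ge0 // psi0 // VI.
  have l_le : l <= \sum_(0 <= j < M) d (K + (i + j))%N.
    have [p pM pE] : exists2 p, (p < M)%N & (ell k = K + (i + p))%N.
      by exists (ell k - (K + i))%N; have := win k; rewrite /k /M; lia.
    rewrite /l pE big_mkord (bigD1 (Ordinal pM)) //= lerDl sumr_ge0 //.
  (* AM-GM, weighted so that the step keeps the coefficient 1/(2M) *)
  set r := (2 * M%:R)^-1 * l + c * D.
  have M20 : 0 <= (2 * M%:R)^-1 :> R by rewrite invr_ge0 mulr_ge0.
  have r0 : 0 <= r by rewrite /r addr_ge0 // mulr_ge0.
  apply: (@le_trans _ _ r); last first.
    by rewrite lerD2r ler_wpM2l.
  apply: (le_trans (step k Kk)); rewrite -/v.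
  have [/ltW C0|C0] := ltP C 0.
    by apply: le_trans r0; rewrite mulr_le0_ge0 // sqrtr_ge0.
  rewrite -(@ler_pXn2r _ 2) ?nnegrE ?mulr_ge0 ?sqrtr_ge0 //.
  rewrite exprMn sqr_sqrtr //.
  apply: (@le_trans _ _ (C ^+ 2 * (b * l * D))).
    by rewrite ler_wpM2l // sqr_ge0.
  have -> : C ^+ 2 * (b * l * D) = 4 * ((2 * M%:R)^-1 * l) * (c * D).
    by rewrite /c; field; rewrite gt_eqF.
  rewrite /r; set p := _^-1 * l; set q := c * D.
  by have := sqr_ge0 (p - q); rewrite -subr_ge0 => H; rewrite -subr_ge0; nra.
exists (\sum_(0 <= i < K) d i + B) => N.
have [NK|KN] := leqP N K.
  rewrite (@big_cat_nat _ _ _ N 0 K) //= -addrA lerDl addr_ge0 ?sumr_ge0 //.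
  by have := HB 0%N; rewrite big_geq.
rewrite (@big_cat_nat _ _ _ K) //= ?(ltnW KN) // lerD2l.
suff <- : \sum_(0 <= i < N - K) d (K + i)%N = \sum_(K <= i < N) d i by exact: HB.
rewrite -{2}(subnK (ltnW KN)) -sum_shift.
by apply: eq_bigr => i _; rewrite addnC.
Qed.

(** * Compactness in finite-dimensional inner product spaces *)

Lemma dot_ge0 (R : realType) (V : lmodType R) (ip : {dot V for idfun}) (v : V) :
  0 <= ip v v.
Proof. by have [->|/neq0_dnorm_gt0/ltW//] := eqVneq v 0; rewrite linear0l. Qed.

(** Induction on the number of generators: split off the component along the
    first one. By Pythagoras both components of a vector of norm at most M have
    norm at most M, so the vector lies in the image of [-M, M] * K', with K'
    given by the induction hypothesis for the projections of the other
    generators. *)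
Lemma span_ball_subcompact (R : realType) (V : normedModType R)
    (ip : {dot V for idfun}) (ipE : forall v : V, `|v| = ip_norm ip v)
    (M : R) (n : nat) (e : 'I_n -> V) :
  exists2 K : set V, compact K &
    forall c : 'I_n -> R, `|\sum_(i < n) c i *: e i| <= M ->
      K (\sum_(i < n) c i *: e i).
Proof.
have ipC u v : ip u v = ip v u by rewrite hermC expr0 mul1r.
have ipnE v : `|v| ^+ 2 = ip v v by rewrite ipE sqr_sqrtr // dot_ge0.
elim: n e => [|n IH] e.
  by exists [set 0]; [exact: compact_set1|move=> c _; rewrite big_ord0].
(* f = 0 when the first generator is 0: with 0^-1 = 0, the two identities
   below hold in both cases *)
pose f := `|e ord0|^-1 *: e ord0.
have f_proj : e ord0 = ip f (e ord0) *: f.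
  have [->|e0] := eqVneq (e ord0) 0; first by rewrite linear0r scale0r.
  rewrite /f linearZl_LR /= -ipnE scalerA (_ : _ / _ = 1) ?scale1r //.
  by field; rewrite normr_eq0.
have ff v : ip f v ^+ 2 * ip f f = ip f v ^+ 2.
  have [e0|e0] := eqVneq (e ord0) 0.
    by rewrite /f e0 scaler0 linear0l expr0n mul0r.
  rewrite -ipnE /f normrZ normfV normr_id mulVf ?normr_eq0 //.
  by rewrite expr1n mulr1.
clearbody f.
have [K' cK' HK'] := IH (fun i => e (lift ord0 i) - ip f (e (lift ord0 i)) *: f).
exists ((fun p : R * V => p.1 *: f + p.2) @` (`[- M, M] `*` K')).
  apply: continuous_compact;
    last by apply: compact_setX => //; exact: segment_compact.
  apply: continuous_subspaceT => p.
  apply: cvgD; last exact: cvg_snd.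
  by apply: cvgZr_tmp; exact: cvg_fst.
move=> c; set v := \sum_(i < n.+1) _ => vM.
set w := \sum_(i < n) c (lift ord0 i) *: (e (lift ord0 i) - ip f (e (lift ord0 i)) *: f).
have vE : v = ip f v *: f + w.
  rewrite /v /w big_ord_recl linearDr linearZr_LR scalerDl -scalerA -f_proj -addrA.
  congr (_ + _).
  rewrite raddf_sum /= scaler_suml -big_split /=; apply: eq_bigr => i _.
  by rewrite linearZr_LR /= -scalerA -scalerDr addrC subrK.
have wE : w = v - ip f v *: f by rewrite {1}vE addrAC subrr add0r.
have pyth : ip f v ^+ 2 + `|w| ^+ 2 = `|v| ^+ 2.
  rewrite !ipnE wE linearBl !linearBr /= !(linearZl_LR, linearZr_LR) /=.
  rewrite (ipC v f); have := ff v.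
  rewrite (_ : ip f v *: (_ * _) = ip f v * (ip f v * ip f f)) //; lra.
have M0 : 0 <= M by apply: le_trans vM.
have v2 : `|v| ^+ 2 <= M ^+ 2 by rewrite ler_pXn2r ?nnegrE.
have fv : `|ip f v| <= M.
  rewrite -(@ler_pXn2r _ 2) ?nnegrE // -normrX ger0_norm ?sqr_ge0 //.
  by apply: le_trans v2; rewrite -pyth lerDl sqr_ge0.
have wM : `|w| <= M.
  rewrite -(@ler_pXn2r _ 2) ?nnegrE //.
  by apply: le_trans v2; rewrite -pyth lerDr sqr_ge0.
exists (ip f v, w); last by rewrite /= -vE.
by split; [rewrite /= in_itv /= -ler_norml|exact: HK'].
Qed.

Lemma ball_subcompact (R : realType) (V : normedModType R)
    (ip : {dot V for idfun}) (M : R) :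
  euclidean ip ->
  exists2 K : set V, compact K & forall v : V, `|v| <= M -> K v.
Proof.
move=> [[n [e span]] ipE].
have [K cK HK] := span_ball_subcompact ipE M e.
by exists K => // v vM; have [c vc] := span v; rewrite vc; apply: HK; rewrite -vc.
Qed.

Lemma norm_le_prod_ip (R : realType) (X Y : normedModType R)
    (ipX : {dot X for idfun}) (ipY : {dot Y for idfun}) :
  euclidean ipX -> euclidean ipY ->
  forall v : X * Y, [/\ `|v.1| <= ip_norm (prod_ip ipX ipY) v,
    `|v.2| <= ip_norm (prod_ip ipX ipY) v & `|v| <= ip_norm (prod_ip ipX ipY) v].
Proof.
move=> [_ hX] [_ hY] v.
have v1 : `|v.1| <= ip_norm (prod_ip ipX ipY) v.
  by rewrite hX ler_wsqrtr // lerDl dot_ge0.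
have v2 : `|v.2| <= ip_norm (prod_ip ipX ipY) v.
  by rewrite hY ler_wsqrtr // lerDr dot_ge0.
by split => //; rewrite prod_normE ge_max v1.
Qed.

(** If Q K failed, the complements in K of the sets satisfying Q would form a
    proper filter containing K. A cluster point of it in K has a neighbourhood
    satisfying Q, whose complement belongs to the filter: a contradiction. *)
Lemma compact_induction (T : topologicalType) (K : set T) (Q : set T -> Prop) :
  compact K -> Q set0 ->
  (forall A B, A `<=` B -> Q B -> Q A) ->
  (forall A B, Q A -> Q B -> Q (A `|` B)) ->
  (forall p, K p -> exists2 U, nbhs p U & Q U) ->
  Q K.
Proof.
move=> cK Q0 Qmono QU Qloc; apply: contrapT => nQK.
pose F : set_system T := [set A | Q (K `\` A)].
have FF : ProperFilter F.
  apply: Build_ProperFilter => [|]; first by rewrite /F /= setD0.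
  split.
  - by rewrite /F /= setDT.
  - by move=> A B FA FB; rewrite /F /= setDIr; exact: QU.
  - by move=> A B AB; apply: Qmono; exact: setDS.
have FK : F K by rewrite /F /= setDv.
have [p [Kp clp]] := cK F FF FK.
have [U pU QU'] := Qloc p Kp.
have FU : F (~` U) by apply: Qmono QU' => x [_ /contrapT].
by have [x []] := clp _ _ FU pU.
Qed.

(** * Sequences and their cluster points *)

Lemma cvg_dominated (R : realType) (V : normedModType R) (a : nat -> V) (l : V)
    (s : nat -> R) :
  (forall j, `|a j - l| <= s j) -> s @ \oo --> 0 -> a @ \oo --> l.
Proof.
move=> as_ s0; apply/cvgrPdistC_le => e e0.
move/cvgrPdistC_le: s0 => /(_ _ e0)[N _ HN].
exists N => // j Nj; apply: (le_trans (as_ j)).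
by apply: le_trans (ler_norm _) _; have := HN j Nj; rewrite subr0.
Qed.

Lemma subsequence_of_frequently (P : nat -> nat -> Prop) :
  (forall j N, exists2 k, (N <= k)%N & P j k) ->
  exists2 s : nat -> nat, {homo s : i j / (i < j)%N} & forall j, P j (s j).
Proof.
move=> freq.
have /choice[next nextP] (jN : nat * nat) : exists k, (jN.2 <= k)%N /\ P jN.1 k.
  by have [k] := freq jN.1 jN.2; exists k.
pose s := fix s j := if j is i.+1 then next (j, (s i).+1) else next (0, 0)%N.
exists s => [|[|j]]; last 2 first.
- by have [] := nextP (0, 0)%N.
- by have [] := nextP (j.+1, (s j).+1).
by apply: homo_ltn => [|i]; [exact: ltn_trans|have [] := nextP (i.+1, (s i).+1)].
Qed.

Lemma homo_ltn_cvgnoo (s : nat -> nat) :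
  {homo s : i j / (i < j)%N} -> s @ \oo --> \oo.
Proof.
move=> hs.
have ge j : (j <= s j)%N by elim: j => // j /leq_ltn_trans; apply; exact: hs.
by move=> A [N _ NA]; exists N => // j /= Nj; apply: NA; exact: leq_trans (ge j).
Qed.

Lemma cluster_frequently (R : realType) (V : normedModType R) (z : nat -> V) (w : V)
    (U : set V) (N : nat) :
  cluster (z @ \oo) w -> nbhs w U -> exists2 k, (N <= k)%N & U (z k).
Proof.
move=> clw wU.
have [|_ [[k Nk <-] Uk]] := clw (z @` [set k | (N <= k)%N]) U _ wU.
  by exists N => // k Nk; exists k.
by exists k.
Qed.

Lemma cluster_subsequence (R : realType) (V : normedModType R) (z : nat -> V) (w : V) :
  cluster (z @ \oo) w ->
  exists2 s : nat -> nat, {homo s : i j / (i < j)%N} & z \o s @ \oo --> w.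
Proof.
move=> clw.
have [|s hs sP] := @subsequence_of_frequently
    (fun j k => `|z k - w| <= j.+1%:R^-1).
  move=> j N; have j0 : (0 : R) < j.+1%:R^-1 by rewrite invr_gt0 ltr0n.
  have [k Nk zk] := cluster_frequently N clw (nbhsx_ballx w _ j0).
  by exists k => //; move: zk; rewrite -ball_normE /ball_ /= distrC => /ltW.
by exists s => //; apply: cvg_dominated sP _; exact: cvg_harmonic.
Qed.

(** V need not be complete, so the limit of this Cauchy sequence is taken from
    its cluster point. *)
Lemma cvg_of_steps_summable (R : realType) (V : normedModType R) (x : nat -> V)
    (B : R) (p : V) :
  (forall N, \sum_(0 <= i < N) `|x i.+1 - x i| <= B) ->
  cluster (x @ \oo) p -> x @ \oo --> p.
Proof.
move=> bnd clp.
pose S N := \sum_(0 <= i < N) `|x i.+1 - x i|.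
have Sdiff n k : (n <= k)%N -> `|x k - x n| <= S k - S n.
  move=> nk; rewrite -(telescope_sumr x nk).
  rewrite /S (@big_cat_nat _ _ _ n 0 k) //= addrAC subrr add0r.
  exact: ler_norm_sum.
have Smono : {homo S : i j / (i <= j)%N >-> i <= j}.
  by move=> n k nk; rewrite -subr_ge0 (le_trans _ (Sdiff _ _ nk)).
have cS : cvgn S.
  by apply: nondecreasing_is_cvgn => //; exists B => _ [N _ <-]; exact: bnd.
apply/cvgrPdistC_le => e e0.
have e2 : 0 < e / 2 by rewrite divr_gt0.
move/cvgrPdist_le: (cS) => /(_ _ e2)[N _ HN].
exists N => // k Nk.
have [||_ [[n kn <-] pn]] := clp (x @` [set n | (k <= n)%N]) (ball p (e / 2)).
- by exists k => // n kn; exists n.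
- exact: nbhsx_ballx.
move: pn; rewrite -ball_normE /ball_ /= distrC => /ltW pn.
rewrite -(subrK (x n) (x k)) -addrA (le_trans (ler_normD _ _)) //.
rewrite [e]splitr lerD // distrC (le_trans (Sdiff _ _ kn)) //.
apply: (@le_trans _ _ (limn S - S k)).
  by rewrite lerD2r; exact: nondecreasing_cvgn_le.
exact: le_trans (ler_norm _) (HN k Nk).
Qed.

(** * The KL inequality along a sequence *)

(** Diagonal argument: a near-minimal limiting subgradient at w j is a limit of
    regular subgradients at points near w j with nearby values of f; one of them,
    chosen at accuracy 1/(j+1), approximates w j, f (w j) and 0 at once. *)
Lemma limiting_subdiff0_closed (R : realType) (V : normedModType R)
    (ip : V -> V -> R) (f : V -> \bar R) (w : nat -> V) (p : V) (r : nat -> R) :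
  (forall v, `|v| <= ip_norm ip v) ->
  w @ \oo --> p -> f p \is a fin_num -> fine (f (w j)) @[j --> \oo] --> fine (f p) ->
  r @ \oo --> 0 ->
  (forall j, (dist0 ip (limiting_subdiff ip f (w j)) <= (r j)%:E)%E) ->
  limiting_subdiff ip f p 0.
Proof.
move=> ip_ge wp fp fwp r0 dist_r.
have approx j : exists yg : V * V,
    [/\ regular_subdiff ip f yg.1 yg.2, `|yg.1 - w j| <= j.+1%:R^-1,
        `|fine (f yg.1) - fine (f (w j))| <= j.+1%:R^-1
      & `|yg.2| <= r j + j.+1%:R^-1 + j.+1%:R^-1].
  have j0 : (0 : R) < j.+1%:R^-1 by rewrite invr_gt0 ltr0n.
  have : (dist0 ip (limiting_subdiff ip f (w j)) < (r j + j.+1%:R^-1)%:E)%E.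
    by apply: (le_lt_trans (dist_r j)); rewrite lte_fin ltrDl.
  move=> /ereal_inf_lt[_ [v [fwj [xs [vs [xsw fxs reg vsv]]]] <-]].
  rewrite lte_fin => vlt.
  have fxs' : fine (f (xs i)) @[i --> \oo] --> fine (f (w j)).
    by apply: fine_cvg; rewrite fineK.
  have /filter_ex[i [[h1 h2] h3]] : \forall i \near \oo,
      (`|xs i - w j| <= j.+1%:R^-1 /\
       `|fine (f (xs i)) - fine (f (w j))| <= j.+1%:R^-1) /\
      `|vs i - v| <= j.+1%:R^-1.
    apply: filterI; first apply: filterI.
    - by move/cvgrPdistC_le : xsw; apply.
    - by move/cvgrPdistC_le : fxs'; apply.
    - by move/cvgrPdistC_le : vsv; apply.
  exists (xs i, vs i); split => //=.
  rewrite -(subrK v (vs i)) (le_trans (ler_normD _ _)) // addrC lerD //.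
  by apply: ltW; apply: le_lt_trans vlt; exact: ip_ge.
have [yg ygP] := choice approx.
split => //; exists (fst \o yg), (snd \o yg); split => /=.
- apply: (@cvg_dominated _ _ _ _ (fun j => j.+1%:R^-1 + `|w j - p|)).
    move=> j /=; rewrite -(subrK (w j) (yg j).1) -addrA.
    by rewrite (le_trans (ler_normD _ _)) // lerD2r; have [] := ygP j.
  rewrite -[0 in X in _ --> X](addr0 0); apply: cvgD; first exact: cvg_harmonic.
  by apply/norm_cvg0P; move/subr_cvg0: wp.
- rewrite -[X in _ --> X](fineK fp).
  apply: cvg_EFin; first by exists 0%N => // j _; have [[]] := ygP j.
  apply: (@cvg_dominated _ R^o _ _
      (fun j => j.+1%:R^-1 + `|fine (f (w j)) - fine (f p)|)).
    move=> j /=; rewrite -(subrK (fine (f (w j))) (fine (f (yg j).1))) -addrA.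
    by rewrite (le_trans (ler_normD _ _)) // lerD2r; have [] := ygP j.
  rewrite -[0 in X in _ --> X](addr0 0); apply: cvgD; first exact: cvg_harmonic.
  by apply/norm_cvg0P; move/subr_cvg0: fwp.
- by move=> j; have [] := ygP j.
- apply: (@cvg_dominated _ _ _ _ (fun j => r j + j.+1%:R^-1 + j.+1%:R^-1)).
    by move=> j; rewrite subr0; have [] := ygP j.
  rewrite -(addr0 0) -{1}(addr0 0).
  by apply: cvgD; [apply: cvgD => //|]; exact: cvg_harmonic.
Qed.

Section KLAlongSequence.
Context {R : realType} {V : normedModType R}.
Variables (ip : V -> V -> R) (Theta : V -> \bar R) (z : nat -> V).
Variables (th r : nat -> R) (om : R).
Hypothesis ip_ge : forall v, `|v| <= ip_norm ip v.
Hypothesis Theta_lsc : lower_semicontinuous Theta.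
Hypothesis Theta_z : forall k, (0 < k)%N -> Theta (z k) = (th k)%:E.
Hypothesis th_le : forall e, 0 < e -> \forall k \near \oo, th k < om + e.
Hypothesis cluster_ge : forall w, cluster (z @ \oo) w -> (om%:E <= Theta w)%E.
Hypothesis r_ge0 : forall k, 0 <= r k.
Hypothesis r0 : r @ \oo --> 0.
Hypothesis dist_r : forall k, (0 < k)%N ->
  (dist0 ip (limiting_subdiff ip Theta (z k)) <= (r k)%:E)%E.

(** Semicontinuity bounds Theta w by the upper limit om of Theta (z k). *)
Lemma Theta_cluster w : cluster (z @ \oo) w -> Theta w = om%:E.
Proof.
move=> clw; apply/eqP; rewrite eq_le cluster_ge // andbT leNgt; apply/negP => lt.
have [c omc cT] : exists2 c : R, om < c & (c%:E < Theta w)%E.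
  case: (Theta w) lt => [t|_|//].
    rewrite lte_fin => omt; exists ((om + t) / 2); first by lra.
    by rewrite lte_fin; lra.
  by exists (om + 1); [lra|exact: ltry].
have [U wU HU] := Theta_lsc cT.
have [|N _ HN] := th_le (e := c - om); first by lra.
have [k Nk Uk] := cluster_frequently N.+1 clw wU.
have := HU _ Uk; rewrite Theta_z; last by lia.
have := HN k (ltnW Nk) => /=; rewrite lte_fin; lra.
Qed.

Lemma cluster_critical w :
  cluster (z @ \oo) w -> limiting_subdiff ip Theta w 0.
Proof.
move=> clw; have Tw := Theta_cluster clw.
have [s0 hs0 zs0] := cluster_subsequence clw.
(* dropping the first term keeps the indices positive *)
pose s j := s0 j.+1.
have hs : {homo s : i j / (i < j)%N} by move=> i j ij; exact: hs0.
have s_gt0 j : (0 < s j)%N by apply: leq_ltn_trans (leq0n (s0 0%N)) _; exact: hs0.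
have soo := homo_ltn_cvgnoo hs.
have zs : z \o s @ \oo --> w.
  by rewrite -cvg_shiftS in zs0.
apply: (@limiting_subdiff0_closed _ _ _ _ (z \o s) _ (r \o s)) => //.
- by rewrite Tw.
- rewrite Tw /=; apply/cvgrPdist_lt => e e0.
  have [|U wU HU] := @Theta_lsc w (om - e); first by rewrite Tw lte_fin; lra.
  have upper : \forall j \near \oo, th (s j) < om + e by exact: soo (th_le e0).
  have lower : \forall j \near \oo, U (z (s j)) by exact: zs.
  near=> j.
  have h1 : th (s j) < om + e by near: j.
  have : U (z (s j)) by near: j.
  move=> /HU; rewrite /= Theta_z // lte_fin => h2.
  by rewrite /= ltr_norml; apply/andP; split; lra.
- exact: cvg_comp soo r0.
- by move=> j; exact: dist_r.
Unshelve. all: by end_near. Qed.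

(** The property that some gauge works for the late indices k with z k in a
    given set passes to finite unions, by adding the gauges. It holds near a
    cluster point of z by the KL property there, and vacuously near any other
    point, so compactness makes it hold for the whole sequence. *)
Lemma kl_along_sequence (K : set V) :
  KL_function ip Theta -> compact K -> (forall k, K (z k)) ->
  exists (eta : R) (phi psi : R -> R) (N : nat), concave_gauge eta phi psi /\
    forall k, (N <= k)%N -> om < th k < om + eta -> 1 <= psi (th k - om) * r k.
Proof.
move=> KL cK Kz.
pose Q (A : set V) := exists (eta : R) (phi psi : R -> R) (N : nat),
  concave_gauge eta phi psi /\
  forall k, (N <= k)%N -> A (z k) -> om < th k < om + eta ->
    1 <= psi (th k - om) * r k.
have Qeventually (A : set V) (N : nat) : (forall k, (N <= k)%N -> ~ A (z k)) -> Q A.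
  move=> NA; exists 1, (fun=> 0), (fun=> 0), N; split; last by move=> k /NA.
  by split => // s t _ _; rewrite mul0r addr0.
suff [eta [phi [psi [N [g H]]]]] : Q K.
  by exists eta, phi, psi, N; split => // k Nk; exact: H.
apply: (compact_induction cK) => [|A B AB [eta [phi [psi [N [g H]]]]]|A B|p Kp].
- by apply: (Qeventually _ 0%N) => k _ [].
- by exists eta, phi, psi, N; split => // k Nk /AB; exact: H.
- move=> [e1 [p1 [q1 [N1 [g1 H1]]]]] [e2 [p2 [q2 [N2 [g2 H2]]]]].
  exists (Num.min e1 e2), (p1 \+ p2), (q1 \+ q2), (maxn N1 N2).
  split; first exact: concave_gaugeD.
  move=> k; rewrite geq_max => /andP[Nk1 Nk2] AB /andP[lo].
  rewrite -ltrBlDl lt_min => /andP[hi1 hi2].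
  have t0 : 0 < th k - om by rewrite subr_gt0.
  have I1 : om < th k < om + e1 by rewrite lo -ltrBlDl.
  have I2 : om < th k < om + e2 by rewrite lo -ltrBlDl.
  have q1k : 0 <= q1 (th k - om) by case: g1 => _ _ q1_ge0 _; rewrite q1_ge0 // t0.
  have q2k : 0 <= q2 (th k - om) by case: g2 => _ _ q2_ge0 _; rewrite q2_ge0 // t0.
  rewrite /= mulrDl; case: AB => [/(H1 _ Nk1)/(_ I1)|/(H2 _ Nk2)/(_ I2)] h.
    by rewrite (le_trans h) // lerDl mulr_ge0.
  by rewrite (le_trans h) // lerDr mulr_ge0.
have [clp|nclp] := pselect (cluster (z @ \oo) p); last first.
  have [U pU [N NU]] : exists2 U, nbhs p U & exists N, forall k, (N <= k)%N -> ~ U (z k).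
    move: nclp => /existsNP[A /existsNP[U /not_implyP[[N _ NA]]]] /not_implyP[pU nAU].
    exists U => //; exists N => k Nk Uk; apply: nAU.
    by exists (z k); split => //; exact: NA.
  by exists U => //; exact: Qeventually NU.
have crit := cluster_critical clp.
have [eta [U [phi [eta0 pU des klU]]]] := KL p (ex_intro _ 0 crit).
have [e e_eta g] := desingularizing_gauge eta0 des.
exists U => //; exists e, phi, (derive1 phi), 1%N; split => // k k0 Uk /andP[lo hi].
have := klU _ Uk; rewrite Theta_z // (Theta_cluster clp) lte_fin => /(_ lo).
have -> : ((th k)%:E < om%:E + eta)%E.
  by apply: (@lt_le_trans _ _ (om%:E + e%:E)%E); rewrite ?lte_fin // leeD2l.
move=> /(_ isT) /= h; rewrite -lee_fin; apply: (le_trans h).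
rewrite EFinM; apply: lee_wpmul2l; last exact: dist_r.
case: g => _ _ psi_ge0 _; rewrite lee_fin psi_ge0 //.
by rewrite subr_gt0 lo ltrBlDl.
Qed.
End KLAlongSequence.

(** * Convergence *)

Theorem theorem4 (R : realType) (X Y : normedModType R)
    (ipX : {dot X for idfun}) (ipY : {dot Y for idfun})
    (hX : euclidean ipX) (hY : euclidean ipY)
    (Phi : X -> \bar R) (m : nat) (x : nat -> X) (z : nat -> X * Y)
    (Phi_proper : proper_fun Phi)
    (Phi_lsc : lower_semicontinuous Phi)
    (Phi_bounded_below : exists c : R, forall v, (c%:E <= Phi v)%E)
    (Phi_x0 : (Phi (x 0%N) < +oo)%E)
    (zx : forall k, (z k).1 = x k)
    (ell := last_argmax m (fun k => Phi (x k)))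
    (ipZ := prod_ip ipX ipY)
    (a : R) (a_gt0 : 0 < a)
    (condA : forall k,
      (Phi (x k.+1) + (a * `|x k.+1 - x k| ^+ 2)%:E <= Phi (x (ell k)))%E)
    (condB : forall (s : nat -> nat) (xbar : X),
      {homo s : i j / (i < j)%N} ->
      x (ell (s j)) @[j --> \oo] --> xbar ->
      (limn_esup (fun j => Phi (x (ell (s j)))) <= Phi xbar)%E)
    (condC : exists (Theta : X * Y -> \bar R) (vs : nat -> R) (b : R),
      [/\ [/\ proper_fun Theta, lower_semicontinuous Theta
            & KL_function ipZ Theta],
          [/\ forall k, 0 <= vs k, vs @ \oo --> (0 : R) & 0 < b],
          forall w, cluster (z @ \oo) w -> (Phi w.1 <= Theta w)%E,
          forall k, (Phi (x k.+1) <= Theta (z k.+1))%E /\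
                    (Theta (z k.+1) <= Phi (x (ell k)) + (vs k)%:E)%E
        & forall k, (1 <= k)%N ->
            (dist0 ipZ (limiting_subdiff ipZ Theta (z k)) <=
             (b * `|x k - x k.-1|)%:E)%E])
    (condD : exists (tau mu : R) (kbar : nat),
      [/\ 0 < tau < 1, 0 < mu, (m < kbar)%N
        & forall k i : nat, (kbar <= k)%N ->
            ((ell k.-1).+1 <= i)%N -> (i <= (ell k).-1)%N ->
            (sqrte (Phi (x (ell k)) - Phi (x i)) <=
             (tau * Num.sqrt a * `|x i - x i.-1| +
              mu * \sum_(i.+1 <= j < (ell k).+1) `|x j - x j.-1|)%:E)%E])
    (z_bounded : exists M : R, forall k, ip_norm ipZ (z k) <= M) :
  (\sum_(1 <= k <oo) (`|x k.+1 - x k|)%:E < +oo)%E /\ cvgn x.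
Proof.
have [c PhiGe] := Phi_bounded_below.
have ell_spec k := last_argmax_spec m (fun k => Phi (x k)) k.
rewrite -/ell in ell_spec.
have win k : (k - m <= ell k <= k)%N by have [] := ell_spec k.
have ell_max k i : (k - m <= i <= k)%N -> (Phi (x i) <= Phi (x (ell k)))%E.
  by have [_] := ell_spec k; apply.
have next_le k : (Phi (x k.+1) <= Phi (x (ell k)))%E.
  apply: le_trans (condA k); rewrite leeDl // lee_fin.
  by rewrite mulr_ge0 ?(ltW a_gt0) // sqr_ge0.
have Phi_le0 k : (Phi (x k) <= Phi (x 0%N))%E.
  elim/ltn_ind: k => -[//|k] IH.
  by apply: (le_trans (next_le k)); apply: IH; have := win k; lia.
have Phi_fin k : Phi (x k) \is a fin_num.
  rewrite fin_real // (lt_le_trans (ltNyr c) (PhiGe _)) /=.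
  exact: le_lt_trans (Phi_le0 k) Phi_x0.
pose u k := fine (Phi (x k)).
have uE k : Phi (x k) = (u k)%:E by rewrite fineK.
pose V k := u (ell k).
pose d k := `|x k - x k.-1|.
have d_ge0 i : 0 <= d i by exact: normr_ge0.
have desc k : u k.+1 + a * d k.+1 ^+ 2 <= V k.
  by have := condA k; rewrite !uE -EFinD lee_fin.
have Vmono : {homo V : i j / (i <= j)%N >-> j <= i}.
  apply: homo_leq => // [y p q yp pq|k]; first exact: le_trans pq yp.
  rewrite -lee_fin /V -!uE; have [->|ne] := eqVneq (ell k.+1) k.+1.
    exact: next_le.
  by apply: ell_max; have := win k.+1; lia.
have V_lb k : c <= V k by rewrite -lee_fin -uE.
have cV : cvgn V.
  by apply: nonincreasing_is_cvgn => //; exists c => _ [k _ <-].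
set om := limn V in cV.
have Vom k : om <= V k by exact: nonincreasing_cvgn_ge.
have [tau [mu [kbar [tauI mu0 _ condD']]]] := condD.
have [C dC] : exists C, forall i, (kbar <= i)%N ->
    d i.+1 <= C * Num.sqrt (V i - V (i + m).+1).
  apply: (step_le_sqrt_drop a_gt0 tauI mu0 d_ge0 win Vmono desc).
  move=> k i kk /andP[lo hi]; rewrite -lee_fin.
  apply: le_trans (condD' k i kk lo _); last by lia.
  by rewrite !uE.
have d0 : (fun k => d k.+1) @ \oo --> (0 : R).
  have W0 : (fun k => C * Num.sqrt (V k - V (k + m).+1)) @ \oo --> (0 : R).
    rewrite -[X in _ --> X](mulr0 C) -(sqrtr0 R) -(subrr om); apply: cvgMl_tmp.
    apply: continuous_cvg; first exact: sqrt_continuous.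
    apply: cvgB => //; rewrite -(cvg_shiftn m.+1) in cV.
    rewrite (_ : (fun k => V (k + m).+1) = (fun k => V (k + m.+1)%N)) //.
    by apply/funext => k; rewrite addnS.
  apply: squeeze_cvgr (cvg_cst 0) W0; exists kbar => // k /= kk.
  by rewrite d_ge0 dC.
have xell0 : (fun k => `|x (ell k) - x k|) @ \oo --> (0 : R).
  exact: cvg_window_diff d0 win.
case: condC => Theta [vs [b [[_ Tlsc TKL] [vs_ge0 vs0 b0] Tcl Tz dT]]].
have Tfin k : (0 < k)%N -> Theta (z k) \is a fin_num.
  case: k => // k _; have [h1 h2] := Tz k.
  rewrite fin_real // (lt_le_trans _ h1) ?uE ?ltNyr //=.
  by rewrite (le_lt_trans h2) // uE -EFinD ltry.
pose th k := fine (Theta (z k)).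
have thE k : (0 < k)%N -> Theta (z k) = (th k)%:E by move=> k0; rewrite fineK // Tfin.
have th_lo k : (0 < k)%N -> u k <= th k.
  by move=> k0; rewrite -lee_fin -uE -thE //; case: k k0 => // k _; have [] := Tz k.
have th_hi e : 0 < e -> \forall k \near \oo, th k < om + e.
  move=> e0; have Vvs : (fun k => V k + vs k) @ \oo --> om.
    by rewrite -[X in _ --> X](addr0 om); exact: cvgD.
  have om_lt : om < om + e by rewrite ltrDl.
  have [N _ HN] := cvgr_lt _ Vvs _ om_lt.
  exists N.+1 => // -[//|k] /= Nk; apply: le_lt_trans (HN k Nk).
  by rewrite -lee_fin -thE // EFinD /V -uE; have [] := Tz k.
have ipZ_ge := norm_le_prod_ip hX hY.
have [M zM] := z_bounded.
have [KX cKX KXP] := ball_subcompact M hX.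
have [KY cKY KYP] := ball_subcompact M hY.
have Kz k : (KX `*` KY) (z k).
  have [h1 h2 _] := ipZ_ge (z k).
  by split; [apply: KXP|apply: KYP]; exact: le_trans (zM k).
have cluster_ge w : cluster (z @ \oo) w -> (om%:E <= Theta w)%E.
  move=> clw; apply: le_trans (Tcl w clw).
  have [s hs zs] := cluster_subsequence clw.
  have soo := homo_ltn_cvgnoo hs.
  have xs : x (ell (s j)) @[j --> \oo] --> w.1.
    apply: (@cvg_dominated _ _ _ _
        (fun j => `|x (ell (s j)) - x (s j)| + `|z (s j) - w|)).
      move=> j /=; rewrite -[X in `|X - w.1|](subrK (x (s j))) -addrA.
      rewrite (le_trans (ler_normD _ _)) // lerD2l.
      by rewrite -zx [leRHS]prod_normE le_max lexx.
    rewrite -[0 in X in _ --> X](addr0 0); apply: cvgD.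
      exact: cvg_comp soo xell0.
    by apply/norm_cvg0P; move/subr_cvg0: zs.
  have := condB s w.1 hs xs.
  have Vs : Phi (x (ell (s j))) @[j --> \oo] --> om%:E.
    apply: cvg_EFin; first by exists 0%N.
    exact: cvg_comp soo cV.
  by rewrite is_cvg_limn_esupE; [rewrite (cvg_lim _ Vs)|apply/cvg_ex; exists om%:E].
have [B HB] : exists B, forall N, \sum_(0 <= i < N) d i <= B.
  (* once V has reached its limit, the step bound makes the sequence stop *)
  have [[k0 Vk0]|neqV] := pselect (exists k, V k = om).
    apply: (@sums_bounded_of_eventually0 _ _ (maxn kbar k0).+1) => // -[//|i].
    rewrite ltnS geq_max => /andP[ki k0i]; apply/eqP; rewrite eq_le d_ge0 andbT.
    have Vi j : (k0 <= j)%N -> V j = om.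
      by move=> kj; apply/eqP; rewrite eq_le Vom -Vk0 Vmono.
    apply: (le_trans (dC i ki)); rewrite !Vi ?subrr ?sqrtr0 ?mulr0 //; lia.
  have Vgt k : om < V k.
    by rewrite lt_neqAle Vom andbT eq_sym; apply/eqP => Vk; apply: neqV; exists k.
  have cK : compact (KX `*` KY) by exact: compact_setX.
  have ip_ge v : `|v| <= ip_norm ipZ v by have [] := ipZ_ge v.
  have r_ge0 k : 0 <= b * d k by rewrite mulr_ge0 // ltW.
  have r0 : (fun k => b * d k) @ \oo --> (0 : R).
    rewrite -[X in _ --> X](mulr0 b); apply: cvgMl_tmp.
    by rewrite -cvg_shiftS.
  have [eta [phi [psi [N [g klN]]]]] :=
    kl_along_sequence ip_ge Tlsc thE th_hi cluster_ge r_ge0 r0 dT TKL cK Kz.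
  have eta0 : 0 < eta by case: g.
  have [N1 _ HN1] := th_hi _ eta0.
  pose K := (kbar + N + N1 + 1 + m)%N.
  have thI k : (K <= k)%N -> om < th (ell k) < om + eta.
    move=> Kk; apply/andP; split.
      by apply: (lt_le_trans (Vgt k)); apply: th_lo; have := win k; lia.
    by apply: HN1 => /=; have := win k; lia.
  have VI k : (K <= k)%N -> 0 < V k - om < eta.
    move=> Kk; rewrite subr_gt0 Vgt /= ltrBlDl.
    apply: (le_lt_trans (y := th (ell k))); last by case/andP: (thI k Kk).
    by apply: th_lo; have := win k; lia.
  apply: (sums_bounded_of_gauge g (ltW b0) d_ge0 win Vmono VI).
    by move=> k Kk; apply: dC; lia.
  (* V k <= th (ell k), and the slope of a concave gauge is antitone *)
  move=> k Kk; have thk := thI k Kk.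
  apply: le_trans (klN (ell k) _ thk) _; first by have := win k; lia.
  rewrite ler_wpM2r //; apply: (concave_gauge_slope_anti g).
  - by case/andP: (VI k Kk).
  - by rewrite lerD2r; apply: th_lo; have := win k; lia.
  - by rewrite ltrBlDl; case/andP: thk.
have sumB N : \sum_(0 <= i < N) `|x i.+1 - x i| <= B.
  apply: le_trans (HB N.+1); rewrite big_nat_recl //= lerDr //.
split.
  apply: (@le_lt_trans _ _ B%:E); last exact: ltry.
  apply: lime_le; first exact: is_cvg_nneseries.
  exists 1%N => // n /= n1; rewrite sumEFin lee_fin.
  apply: le_trans (sumB n); rewrite [leRHS](@big_cat_nat _ _ _ 1) //= lerDr.
  exact: sumr_ge0.
have Kx : (x @ \oo) KX by exists 0%N => // k _; rewrite /= -zx; have [] := Kz k.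
have [p [_ clp]] := cKX _ _ Kx.
by apply/cvg_ex; exists p; exact: cvg_of_steps_summable sumB clp.
Qed.
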